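(* Let $K\subset\mathbb{R}^d$ be any convex body, let $|\cdot|$ be the Lebesgue measure (volume) on $\mathbb{R}^d$, taken as the Haar measure of $\mathbb{R}^d$, and let $\nu$ be any (nonnegative, possibly infinite) measure on $\mathbb{R}^d$ with $\sigma$-algebra of measurable sets $\mathcal{S}$ (containing the Borel sets). Then $$\overline{D}(\nu;|\cdot|)=\overline{D}_K(\nu).$$ The same statement holds for $\mathbb{Z}^d$: for any convex body $K\subset \mathbb{R}^d$ and any (nonnegative, possibly infinite) measure $\nu$ defined on all subsets of $\mathbb{Z}^d$, one has $\overline{D}(\nu;\#)=\overline{D}_K(\nu)$, where $\#$ is the counting measure (the Haar measure of the discrete group $\mathbb{Z}^d$).
   Context: A convex body is a compact convex set with nonempty interior. For a locally compact abelian (LCA) group $G$ with Haar measure $\mu$, let $\mathcal{B}_0$ be the family of Borel subsets of $G$ with compact closure, and write $C\Subset G$ for ''$C$ is a compact subset of $G$''. For a measure $\nu$ on $G$ with $\sigma$-algebra $\mathcal{S}$ of measurable sets, the uniform asymptotic upper density is $$\overline{D}(\nu;\mu):=\inf_{C\Subset G}\ \sup_{V\in\mathcal{S}\cap\mathcal{B}_0}\frac{\nu(V)}{\mu(C+V)}\in[0,\infty].$$ Conventions: $C\ne\emptyset$; $\mu(C+V)$ means outer measure if $C+V$ is not measurable; a quotient $0/0$ is read as $0$ and $a/0$ with $a>0$ as $+\infty$. The classical density with respect to $K$ in $\mathbb{R}^d$ is $$\overline{D}_K(\nu):=\limsup_{r\to\infty}\frac{\sup_{x\in\mathbb{R}^d}\nu(rK+x)}{|rK|}\in[0,\infty],$$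 and in $\mathbb{Z}^d$ it is $$\overline{D}_K(\nu):=\limsup_{r\to\infty}\frac{\sup_{x\in\mathbb{Z}^d}\nu\big((rK+x)\cap\mathbb{Z}^d\big)}{\#(rK\cap\mathbb{Z}^d)}.$$ *)

(* Defs.v *)
From HB Require Import structures.
From mathcomp Require Import all_boot all_order all_algebra.
From mathcomp Require Import all_classical all_reals all_analysis.
Import Order.TTheory GRing.Theory Num.Theory.
Import numFieldNormedType.Exports.

Set Implicit Arguments.
Unset Strict Implicit.
Unset Printing Implicit Defensive.

Local Open Scope classical_set_scope.
Local Open Scope ring_scope.

Definition minkowski_sum (G : zmodType) (C V : set G) : set G :=
  [set c + v | c in C & v in V].

Definition bounded_borel (G : topologicalType) : set (set G) :=
  [set V | <<s [set U : set G | open U] >> V /\ compact (closure V)].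

(* [mu] is the outer measure of the Haar measure of G: it agrees with the Haar
   measure on measurable sets, and C + V need not be measurable.
   Extended-real division satisfies 0 / 0 = 0 and a / 0 = +oo for a > 0. *)
Definition upper_density (R : realType) (G : topologicalZmodType)
    (S : set (set G)) (nu mu : set G -> \bar R) : \bar R :=
  ereal_inf [set
    ereal_sup [set (nu V / mu (minkowski_sum C V))%E
              | V in S `&` @bounded_borel G]
    | C in [set C : set G | compact C /\ C !=set0]].

Definition convex_body (R : realType) (d : nat) (K : set 'rV[R]_d) : Prop :=
  [/\ compact K, convex_set K & interior K !=set0].

Definition dilate (R : realType) (d : nat) (K : set 'rV[R]_d) (r : R)
    (x : 'rV[R]_d) : set 'rV[R]_d :=
  [set r *: k + x | k in K].

Definition box (R : realType) (d : nat) (a b : 'rV[R]_d) : set 'rV[R]_d :=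
  [set x | forall i, a 0 i <= x 0 i <= b 0 i].

(* The Lebesgue outer measure on R^d, defined on all sets: infimum of the total
   volume of the countable (possibly finite, whence the index predicate P)
   covers by nonempty closed boxes.  It restricts to the Lebesgue measure on
   Lebesgue-measurable sets.  The predicate P is what makes the case d = 0
   correct, where every nonempty box has volume 1. *)
Definition lebesgue_outer (R : realType) (d : nat) (A : set 'rV[R]_d) : \bar R :=
  ereal_inf [set v | exists (P : pred nat) (a b : nat -> 'rV[R]_d),
    [/\ forall k, P k -> forall i, a k 0 i <= b k 0 i,
        A `<=` \bigcup_(k in [set k | P k]) box (a k) (b k) &
        v = (\sum_(0 <= k <oo | P k) (\prod_(i < d) (b k 0 i - a k 0 i))%:E)%E]].

Definition classical_density (R : realType) (d : nat) (K : set 'rV[R]_d)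
    (nu : set 'rV[R]_d -> \bar R) : \bar R :=
  limf_esup (fun r : R =>
    (ereal_sup [set nu (dilate K r x) | x in [set: 'rV[R]_d]]
     / lebesgue_outer (dilate K r 0))%E) +oo_R.

Definition lattice (d : nat) : Type := discrete_topology 'rV[int]_d.

HB.instance Definition _ (d : nat) := DiscreteTopology.on (lattice d).
HB.instance Definition _ (d : nat) := GRing.Zmodule.copy (lattice d) 'rV[int]_d.
HB.instance Definition _ (d : nat) := isPointed.Build (lattice d) 0.

Lemma lattice_sub_continuous (d : nat) :
  continuous (fun x : lattice d * lattice d => x.1 - x.2).
Proof.
move=> [x y] A /=; rewrite /= => /nbhs_singleton Axy.
exists ([set x], [set y]) => /=; first by split; exact: discrete_set1.
by move=> [u v] /= [-> ->].
Qed.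

HB.instance Definition _ (d : nat) :=
  PreTopologicalNmodule_isTopologicalZmodule.Build (lattice d)
    (@lattice_sub_continuous d).

Definition lattice_embedding (R : realType) (d : nat) (z : lattice d) :
    'rV[R]_d :=
  map_mx intr (z : 'rV[int]_d).

Definition lattice_trace (R : realType) (d : nat) (A : set 'rV[R]_d) :
    set (lattice d) :=
  @lattice_embedding R d @^-1` A.

Definition lattice_classical_density (R : realType) (d : nat)
    (K : set 'rV[R]_d) (nu : set (lattice d) -> \bar R) : \bar R :=
  limf_esup (fun r : R =>
    (ereal_sup [set nu (lattice_trace (dilate K r (lattice_embedding R x)))
               | x in [set: lattice d]]
     / counting (lattice_trace (dilate K r 0)))%E) +oo_R.

(* Main.v *)
(** Write [t] for the reciprocal of the radius of a ball contained in [K].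
    Comparing a dilate of [K] with the union of the unit cubes based at its
    lattice points, the number [N] of lattice points of [r K + x] satisfies
    [(r - t)^d |K| <= N <= (r + t)^d |K|], uniformly in [x].

    For a compact [C], convexity gives [C + r K + x] inside a translate of
    [(r + s) K], with [s] depending only on [C]; as [(r + s)^d / r^d] tends
    to 1, testing the uniform density on [V = r K + x] bounds [D_K] by [D].

    Conversely, average over lattice translates: each point of [V] lies in at
    least [(r - t)^d |K|] of the sets [r K + z] with [z] integral, and the unit
    cubes based at those [z] for which [r K + z] meets [V] are contained in
    [C + V] for a large box [C], so that
    [(r - t)^d |K| nu(V) <= |C + V| sup_x nu(r K + x)].
    In the lattice, [C = - (r K)] and the counting measure make the same double
    counting exact. *)
Require Import Defs.
From HB Require Import structures.
From mathcomp Require Import all_boot all_order all_algebra finmap.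
From mathcomp Require Import all_classical all_reals all_analysis.
From mathcomp Require Import measurable_realfun ring lra zify.
Import Order.TTheory GRing.Theory Num.Theory.
Import numFieldNormedType.Exports.

Set Implicit Arguments.
Unset Strict Implicit.
Unset Printing Implicit Defensive.

Local Open Scope classical_set_scope.
Local Open Scope ring_scope.

(** * Perturbed products and grid points in boxes *)

(** The left-hand product is a polynomial in [h], hence continuous at 0. This pays for enlarging
    covering boxes, and with all [l i = 1] it gives [(1 + h) ^ d <= 1 + e]. *)
Lemma prod_perturb (R : realType) (I : finType) (l : I -> R) (e : R) :
  0 < e -> exists2 h, 0 < h & \prod_i (l i + h) <= \prod_i l i + e.
Proof.
move=> e0; pose p : {poly R} := \prod_i ((l i)%:P + 'X).
have pE h : p.[h] = \prod_i (l i + h).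
  by rewrite horner_prod; apply: eq_bigr => i _; rewrite !hornerE.
have /cvgrPdist_le/(_ _ e0) := @continuous_horner R p 0.
move=> /nbhs_ballP[h /= h0 ph]; exists (h / 2); first by rewrite divr_gt0.
have {ph} : `|p.[0] - p.[h / 2]| <= e.
  apply: ph; rewrite /ball/= sub0r normrN gtr0_norm ?divr_gt0//.
  by rewrite ltr_pdivrMr// mulr2n mulrDr mulr1 ltrDl.
rewrite !pE distrC => /(le_trans (ler_norm _)); rewrite lerBlDl.
by under [X in X + _]eq_bigr do rewrite addr0.
Qed.

(* The number of integer points of [m a, m b] is at most m (b - a) + 1 per
   coordinate, while each unit cube accounts for m ^ d points. *)
Lemma cubes_le_finite_cover (R : realType) (d N m : nat)
    (z : 'I_N -> 'rV[int]_d) (s : seq nat) (a b : nat -> 'rV[R]_d) :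
  injective z -> (0 < m)%N ->
  (forall k, k \in s -> forall i, a k 0 i <= b k 0 i) ->
  (forall j (x : 'rV[R]_d),
     (forall i, (z j 0 i)%:~R <= x 0 i <= (z j 0 i)%:~R + 1) ->
     exists2 k, k \in s & box (a k) (b k) x) ->
  N%:R <= \sum_(k <- s) \prod_i (b k 0 i - a k 0 i + m%:R^-1).
Proof.
move=> zinj m0 ab cov; have mR0 : 0 < m%:R :> R by rewrite ltr0n.
(* An element of [T] is a point of the grid of mesh [1 / m] in one of the half-open cubes [z j +
   [0, 1)^d]; [q] gives its coordinates multiplied by [m]. *)
pose T : finType := ('I_N * {ffun 'I_d -> 'I_m})%type.
pose q (t : T) i : int := z t.1 0 i * m%:Z + (t.2 i : nat)%:Z.
(* Half-open cubes are disjoint: the residue of [q t i] modulo [m] recovers the offset, and what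
   remains recovers the cube. *)
have q_inj t t' : q t =1 q t' -> t = t'.
  case: t t' => [j f] [j' f'] qq.
  have fE i : f i = f' i :> nat.
    have := congr1 (modz^~ m) (qq i); rewrite /q/= !modzMDl !modz_nat => -[].
    by rewrite !modn_small.
  congr pair; last by apply/ffunP => i; apply/val_inj/fE.
  apply: zinj; apply/rowP => i; have := qq i; rewrite /q/= fE => /addIr.
  by apply: mulIf; rewrite eqz_nat -lt0n.
pose A k : {set T} :=
  [set t | [forall i, m%:R * a k 0 i <= (q t i)%:~R <= m%:R * b k 0 i]]%SET.
have TA : (#|T| <= \sum_(k <- s) #|A k|)%N.
  have cover1 t : (1 <= \sum_(k <- s) (t \in A k))%N.
    pose x : 'rV[R]_d := \row_i ((q t i)%:~R / m%:R).
    have [i|k ks kx] := cov t.1 x.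
      rewrite mxE /q rmorphD rmorphM/= mulrDl mulfK ?gt_eqF//.
      rewrite lerDl divr_ge0//= lerD2l ler_pdivrMr// mul1r ler_nat.
      exact/ltnW/ltn_ord.
    rewrite (big_rem k ks)/= (_ : t \in A k = true)//.
    rewrite inE; apply/forallP => i.
    have := kx i; rewrite mxE ler_pdivlMr// ler_pdivrMr//.
    by rewrite ![_ * m%:R]mulrC.
  rewrite -sum1_card (leq_trans (leq_sum _ (fun t _ => cover1 t)))//.
  rewrite exchange_big/= leq_sum// => k _.
  rewrite -sum1_card [leqRHS]big_mkcond/=; apply: leq_sum => t _.
  by case: (t \in A k).
have Ale k : k \in s -> #|A k|%:R <= \prod_i (m%:R * (b k 0 i - a k 0 i) + 1).
  move=> ks.
  (* An interval of length [L] holds at most [floor L + 1] integers. The map [g] below records, per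
     coordinate, the offset from the least integer of the interval, and [n i] bounds that offset. *)
  pose n i := Num.truncn (m%:R * (b k 0 i - a k 0 i)).
  have qa t i : t \in A k -> (0 <= q t i - Num.ceil (m%:R * a k 0 i))%R /\
      (`|q t i - Num.ceil (m%:R * a k 0%R i)%R|%N < (n i).+1)%N.
    rewrite inE => /forallP/(_ i)/andP[aq qb].
    have q0 : 0 <= q t i - Num.ceil (m%:R * a k 0 i).
      by rewrite subr_ge0 ceil_le_int.
    split=> //; rewrite ltnS /n.
    rewrite truncn_ge_nat ?mulr_ge0 ?subr_ge0 ?ab// natr_absz ger0_norm//.
    rewrite rmorphB/= mulrBr; apply: lerB => //; exact: ceil_ge.
  pose g (t : T) : {dffun forall i : 'I_d, 'I_(n i).+1} :=
    [ffun i => inord `|q t i - Num.ceil (m%:R * a k 0%R i)%R|%N].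
  have ginj : {in A k &, injective g}.
    move=> t t' tA t'A /ffunP gg; apply: q_inj => i.
    have := congr1 val (gg i); rewrite !ffunE /=.
    have [q0 qn] := qa t i tA; have [q0' qn'] := qa t' i t'A.
    rewrite !inordK// => /(congr1 Posz); rewrite !gez0_abs//; exact: addIr.
  rewrite -(card_in_imset ginj).
  apply: (@le_trans _ _ (\prod_i (n i).+1)%:R).
    rewrite ler_nat (leq_trans (max_card _))// card_dep_ffun.
    by rewrite foldrE big_image/=; under eq_bigr do rewrite card_ord.
  rewrite natr_prod; apply: ler_prod => i _; rewrite ler0n/= -natr1 lerD2r.
  by rewrite truncn_le mulr_ge0// subr_ge0 ab.
have mdE : #|T|%:R = N%:R * m%:R ^+ d :> R.
  by rewrite card_prod card_ord card_ffun !card_ord natrM natrX.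
rewrite -(@ler_pM2r _ (m%:R ^+ d)) ?exprn_gt0// -mdE big_distrl/=.
apply: (@le_trans _ _ (\sum_(k <- s) #|A k|%:R)).
  by rewrite -natr_sum ler_nat.
rewrite big_seq [leRHS]big_seq; apply: ler_sum => k ks.
rewrite (le_trans (Ale k ks))//.
rewrite -[d in _ ^+ d]card_ord -prodr_const -big_split/=.
apply: ler_prod => i _; rewrite addr_ge0 ?mulr_ge0 ?subr_ge0 ?ab//=.
by rewrite mulrDl mulVf ?gt_eqF// mulrC.
Qed.

(** * The outer Lebesgue measure of unions of unit cubes *)

Lemma box_compact (R : realType) (d : nat) (a b : 'rV[R]_d) :
  compact (box a b).
Proof.
rewrite (_ : box a b = [set v | forall i, `[a 0 i, b 0 i]%classic (v ord0 i)]).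
  apply: (@rV_compact R d (fun i => `[a 0 i, b 0 i]%classic)) => i.
  exact: segment_compact.
by apply/seteqP; split=> v ab i; have := ab i; rewrite /= in_itv.
Qed.

Lemma open_box_open (R : realType) (d : nat) (a b : 'I_d -> R) :
  open [set x : 'rV[R]_d | forall i, a i < x 0 i < b i].
Proof.
rewrite openE => x /= xab.
apply: (@filter_forall _ _
  (fun i (y : 'rV[R]_d) => a i < y 0 i < b i) (nbhs x)).
move=> i; have xi : nbhs (x 0 i) [set y | y \in `]a i, b i[].
  by have /near_in_itvoo : x 0 i \in `]a i, b i[ by rewrite in_itv/= xab.
have xi' := @coord_continuous R 1 d 0 i x _ xi.
by apply: (@filterS _ (nbhs x) _ _ _ _ xi') => y; rewrite /= in_itv.
Qed.

(** Supplies a single grid mesh that fits the slack of every box of a finite subcover. *)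
Lemma finite_pos_lbound (R : realType) (s : seq nat) (h : nat -> R) :
  (forall k, 0 < h k) -> exists2 m, (0 < m)%N &
    forall k, k \in s -> m%:R^-1 <= h k.
Proof.
move=> h0; elim: s => [|k s [m m0 IH]]; first by exists 1%N.
exists (maxn (Num.truncn (h k)^-1).+1 m); first by rewrite leq_max.
move=> j; rewrite inE => /orP[/eqP->|/IH]; last first.
  apply: le_trans; rewrite lef_pV2 ?posrE ?ltr0n ?leq_max ?m0 ?orbT//.
  by rewrite ler_nat leq_maxr.
rewrite -[leRHS]invrK lef_pV2 ?posrE ?invr_gt0// ?ltr0n ?leq_max//.
by rewrite (le_trans (ltW (truncnS_gt _)))// ler_nat leq_maxl.
Qed.

(** The finite sum is part of the partial sum up to the largest index in [s]. It takes a finite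
    subcover back to the volume of the whole cover. *)
Lemma sub_eseries (R : realType) (s : seq nat) (P : pred nat)
    (f : nat -> \bar R) :
  uniq s -> {subset s <= P} -> (forall k, 0 <= f k)%E ->
  (\sum_(k <- s) f k <= \sum_(0 <= k <oo | P k) f k)%E.
Proof.
move=> us sP f0; pose n := (\max_(k <- s) k).+1.
apply: (@le_trans _ _ (\sum_(0 <= k < n | P k) f k)%E); last first.
  exact: nneseries_lim_ge.
rewrite (_ : (\sum_(k <- s) f k = \sum_(0 <= k < n | k \in s) f k)%E).
  by apply: lee_sum_nneg_subset.
rewrite -[RHS]big_filter; apply: perm_big; apply: uniq_perm => //.
  by rewrite filter_uniq// iota_uniq.
move=> k; rewrite mem_filter mem_index_iota leq0n/= ltnS.
by case: (boolP (k \in s)) => //= ks; apply/esym; exact: leq_bigmax_seq.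
Qed.

(** Closed, so that finite unions are compact; distinct cubes may share faces. *)
Definition unit_cube (R : realType) (d : nat) (z : 'rV[int]_d) : set 'rV[R]_d :=
  box (lattice_embedding R z) (lattice_embedding R z + const_mx 1).
Arguments unit_cube R {d} z.

Lemma unit_cubeE (R : realType) (d : nat) (z : 'rV[int]_d) (x : 'rV[R]_d) :
  unit_cube R z x <-> forall i, (z 0 i)%:~R <= x 0 i <= (z 0 i)%:~R + 1.
Proof. by split=> zx i; have := zx i; rewrite !mxE. Qed.

(** By Heine-Borel: the boxes of a countable cover are made open at a cost of [e / 2 ^ k.+1] each, a
    finite subcover of the compact union of cubes is extracted, and a fine grid compares the two
    volumes. *)
Lemma cubes_le_lebesgue (R : realType) (d N : nat) (z : 'I_N -> 'rV[int]_d)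
    (A : set 'rV[R]_d) :
  injective z -> (forall j, unit_cube R (z j) `<=` A) ->
  (N%:R%:E <= lebesgue_outer A)%E.
Proof.
move=> zinj zA; apply: le_ereal_inf_tmp => _ [P [a [b [ab cov ->]]]].
apply/lee_addgt0Pr => e e0.
pose l k i := b k 0 i - a k 0 i.
(* [2 h] pays for making the boxes open, [h] for the mesh [1 / m] of the grid *)
have /choice[h hP] k : exists h, 0 < h /\
    \prod_i (l k i + 3 * h) <= \prod_i l k i + e / (2 ^ k.+1)%:R.
  have [|h h0 hl] := @prod_perturb R _ (l k) (e / (2 ^ k.+1)%:R).
    by rewrite divr_gt0// ltr0n expn_gt0.
  by exists (h / 3); rewrite divr_gt0// mulrC mulfVK.
have h0 k : 0 < h k by have [] := hP k.
pose U k := [set x : 'rV[R]_d |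
  forall i, a k 0 i - h k < x 0 i < b k 0 i + h k].
have : compact (\big[setU/set0]_(j < N) unit_cube R (z j)).
  by apply: bigsetU_compact => j _; exact: box_compact.
rewrite compact_cover => /(_ _ [set k | P k] U)[].
- by move=> k _; exact: open_box_open.
- rewrite -bigcup_seq => x [j _] /zA /cov[k Pk kx].
  exists k => // i; have /andP[ax xb] := kx i.
  by rewrite (lt_le_trans _ ax) ?(le_lt_trans xb)// ?ltrDl// gtrBl.
move=> D DP covD.
have [m m0 mh] := finite_pos_lbound D h0.
have {covD} ND : N%:R <= \sum_(k <- D) \prod_i (l k i + 2 * h k + m%:R^-1).
  (* The grid count is stated for closed boxes, so each open box is replaced by the closed box with
     the same corners. *)
  pose a' k := a k - const_mx (h k); pose b' k := b k + const_mx (h k).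
  have -> : \sum_(k <- D) \prod_i (l k i + 2 * h k + m%:R^-1) =
      \sum_(k <- D) \prod_i (b' k 0 i - a' k 0 i + m%:R^-1).
    by apply: eq_bigr => k _; apply: eq_bigr => i _; rewrite !mxE /l; lra.
  apply: (cubes_le_finite_cover zinj m0).
    move=> k kD i; have := DP k kD; rewrite inE/= => /ab /(_ i).
    by have := h0 k; rewrite !mxE; lra.
  move=> j x zx; have [|k kD kx] := covD x.
    rewrite -bigcup_seq; exists j; last exact/unit_cubeE.
    by rewrite /= mem_index_enum.
  by exists k => // i; have := kx i; rewrite !mxE => /andP[/ltW-> /ltW->].
have l0 k i : k \in D -> 0 <= l k i.
  by move=> /DP; rewrite inE => /ab/(_ i); rewrite subr_ge0.
(* Outside [P] the corners are unconstrained and the product may be negative, whereas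
   [epsilon_trick] wants every term nonnegative; hence the value 0 there. *)
pose A' k : \bar R := (if P k then \prod_i l k i else 0)%:E.
have A'0 k : (0 <= A' k)%E.
  rewrite lee_fin; case: ifP => // Pk; apply: prodr_ge0 => i _.
  by rewrite subr_ge0 ab.
rewrite [X in (X + _)%E](@eq_eseriesr _ _ A'); last first.
  by move=> k Pk; rewrite /A' Pk.
apply: le_trans (epsilon_trick P A'0 (ltW e0)).
have DP' : {subset D <= P} by move=> k /DP; rewrite inE.
apply: le_trans (sub_eseries (fset_uniq D) DP' _); last first.
  by move=> k; rewrite adde_ge0// lee_fin divr_ge0// ltW.
apply: (@le_trans _ _ (\sum_(k <- D) \prod_i (l k i + 3 * h k))%:E).
  rewrite lee_fin (le_trans ND)// big_seq [leRHS]big_seq.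
  apply: ler_sum => k kD.
  apply: ler_prod => i _; have := mh k kD; have := l0 k i kD; have := h0 k.
  have : 0 < m%:R^-1 :> R by rewrite invr_gt0 ltr0n.
  by move=> *; apply/andP; split; lra.
rewrite -sumEFin big_seq [leRHS]big_seq; apply: lee_sum => k kD.
have [_ hk] := hP k; rewrite /A' ifT -?EFinD ?lee_fin//; exact: DP'.
Qed.

Lemma lebesgue_le_cubes (R : realType) (d N : nat) (z : 'I_N -> 'rV[int]_d)
    (A : set 'rV[R]_d) :
  A `<=` \bigcup_j unit_cube R (z j) -> (lebesgue_outer A <= N%:R%:E)%E.
Proof.
move=> Az.
pose u k : 'rV[R]_d :=
  if insub k is Some j then lattice_embedding R (z j) else 0.
apply: ge_ereal_inf; exists (N%:R%:E) => //.
exists (fun k => (k < N)%N), u, (fun k => u k + const_mx 1); split.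
- by move=> k _ i; rewrite !mxE lerDl.
- move=> x /Az[j _ jx]; exists (val j) => /=; first exact: ltn_ord.
  by rewrite /u valK.
rewrite [RHS](_ : _ = \sum_(0 <= k <oo | (k < N)%N) 1%:E)%E; last first.
  apply: eq_eseriesr => k _; congr EFin; rewrite big1// => i _.
  by rewrite !mxE addrAC subrr add0r.
rewrite (@nneseries_split_cond _ _ 0 N)// add0n eseries_cond.
rewrite [X in (_ + X)%E]eseries_pred0 ?adde0; last by move=> k; lia.
rewrite big_nat_cond (eq_bigl (fun k => (0 <= k < N)%N)); last by move=> k; lia.
by rewrite -big_nat sumEFin sumr_const_nat subn0.
Qed.

(** The finite case applies to every finite subset of [F]; an infinite [F] has arbitrarily large
    ones, which forces infinite outer measure. Thus the bound also proves [F] finite when [A] has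
    finite measure. *)
Lemma counting_le_lebesgue (R : realType) (d : nat) (F : set (lattice d))
    (A : set 'rV[R]_d) :
  (forall z, F z -> unit_cube R z `<=` A) ->
  (counting F <= lebesgue_outer A)%E.
Proof.
move=> FA.
have fsetA (B : {fset lattice d}) : [set` B] `<=` F ->
    ((#|` B|)%:R%:E <= lebesgue_outer A)%E.
  move=> BF; pose z (j : 'I_(#|` B|)) : 'rV[int]_d := nth (0 : lattice d) B j.
  apply: (@cubes_le_lebesgue _ _ _ z) => [i j /eqP|j].
    rewrite /z (nth_uniq (0 : lattice d) _ _ (fset_uniq B)) ?ltn_ord//.
    by move=> /eqP/val_inj.
  by apply/FA/BF; rewrite /= mem_nth.
rewrite /counting; case: asboolP => [finF|infF].
  by apply: fsetA; rewrite fset_setK.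
rewrite leye_eq; apply/eqP/eq_infty => t.
have [B BF nB] := infinite_set_fset (Num.truncn t).+1 infF.
rewrite (le_trans _ (fsetA _ BF))// lee_fin.
by rewrite (le_trans (ltW (truncnS_gt _)))// ler_nat.
Qed.

Lemma lebesgue_le_counting (R : realType) (d : nat) (F : set (lattice d))
    (A : set 'rV[R]_d) :
  A `<=` \bigcup_(z in F) unit_cube R z ->
  (lebesgue_outer A <= counting F)%E.
Proof.
move=> AF; rewrite /counting; case: asboolP => [finF|_]; last exact: leey.
pose z (j : 'I_(#|` fset_set F|)) : 'rV[int]_d :=
  nth (0 : lattice d) (fset_set F) j.
apply: (@lebesgue_le_cubes _ _ _ z) => x /AF[y Fy yx].
have yF : y \in fset_set F by rewrite in_fset_set// inE.
have iF : (index y (fset_set F) < #|` fset_set F|)%N by rewrite index_mem.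
by exists (Ordinal iF) => //; rewrite /z nth_index.
Qed.

(** * Monotonicity and scaling of the outer measure, growth of powers *)

Lemma lebesgue_outer_ge0 (R : realType) (d : nat) (A : set 'rV[R]_d) :
  (0 <= lebesgue_outer A)%E.
Proof.
apply: le_ereal_inf_tmp => _ [P [a [b [ab cov ->]]]].
apply: nneseries_ge0 => k _ Pk; rewrite lee_fin prodr_ge0// => i _.
by rewrite subr_ge0 ab.
Qed.

Lemma le_lebesgue_outer (R : realType) (d : nat) (A B : set 'rV[R]_d) :
  A `<=` B -> (lebesgue_outer A <= lebesgue_outer B)%E.
Proof.
move=> AB; apply: ereal_inf_le_tmp => _ [P [a [b [ab cov ->]]]].
by exists P, a, b; split => //; exact: subset_trans cov.
Qed.

Lemma lebesgue_outer_box (R : realType) (d : nat) (a b : 'rV[R]_d) :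
  (forall i, a 0 i <= b 0 i) -> (lebesgue_outer (box a b) < +oo)%E.
Proof.
move=> ab; apply: (@le_lt_trans _ _ (\prod_i (b 0 i - a 0 i))%:E); last first.
  exact: ltry.
apply: ge_ereal_inf; exists (\prod_i (b 0 i - a 0 i))%:E => //.
exists (fun k => (k < 1)%N), (fun=> a), (fun=> b); split => //.
  by move=> x abx; exists 0%N.
rewrite (@nneseries_split_cond _ _ 0 1)//; last first.
  by move=> k _; rewrite lee_fin prodr_ge0// => i _; rewrite subr_ge0.
rewrite add0n eseries_cond [X in (_ + X)%E]eseries_pred0 ?adde0.
  by rewrite big_mkord [RHS]big_mkcond big_ord1.
by move=> k; lia.
Qed.

(** Scaling the boxes of a cover gives one inequality; the other is the same inequality for the
    inverse dilation. *)
Lemma lebesgue_outer_dilate (R : realType) (d : nat) (A : set 'rV[R]_d)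
    (r : R) (x : 'rV[R]_d) :
  0 < r -> lebesgue_outer (dilate A r x) = ((r ^+ d)%:E * lebesgue_outer A)%E.
Proof.
have dilate_le (B : set 'rV[R]_d) t y : 0 < t ->
    (lebesgue_outer (dilate B t y) <= (t ^+ d)%:E * lebesgue_outer B)%E.
  move=> t0; have td0 : 0 < t ^+ d by rewrite exprn_gt0.
  rewrite -lee_pdivrMl//; apply: le_ereal_inf_tmp => _ [P [a [b [ab cov ->]]]].
  rewrite lee_pdivrMl//; apply: ge_ereal_inf; eexists; last exact: lexx.
  exists P, (fun k => t *: a k + y), (fun k => t *: b k + y); split.
  - by move=> k Pk i; rewrite !mxE lerD2r ler_pM2l// ab.
  - move=> _ [z Bz <-]; have [k Pk kz] := cov _ Bz; exists k => // i.
    by have := kz i; rewrite !mxE !lerD2r !ler_pM2l.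
  rewrite -nneseriesZl; last first.
    by move=> k Pk; rewrite lee_fin prodr_ge0// => i _; rewrite subr_ge0 ab.
  apply: eq_eseriesr => k Pk; rewrite -EFinM; congr EFin.
  rewrite -[d in t ^+ d]card_ord -prodr_const -big_split/=.
  by apply: eq_bigr => i _; rewrite !mxE; lra.
move=> r0; apply/le_anti/andP; split; first exact: dilate_le.
have rd0 : 0 < r ^+ d by rewrite exprn_gt0.
rewrite -lee_pdivlMl// -exprVn.
have dK z : r^-1 *: (r *: z + x) - r^-1 *: x = z.
  by rewrite scalerDr addrK scalerA mulVf ?gt_eqF// scale1r.
have AE : A = dilate (dilate A r x) r^-1 (- (r^-1 *: x)).
  apply/seteqP; split => [z Az|_ [_ [z Az <-] <-]]; last by rewrite dK.
  by exists (r *: z + x) => //; exists z.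
by rewrite [X in (lebesgue_outer X <= _)%E]AE dilate_le// invr_gt0.
Qed.

Lemma exprD_asymp (R : realType) (d : nat) (a b e : R) : 0 < e ->
  exists r0, forall r, r0 < r ->
    0 < r - b /\ (r + a) ^+ d <= (1 + e) * (r - b) ^+ d.
Proof.
move=> e0; have [h h0] := @prod_perturb R 'I_d (fun=> 1) e e0.
rewrite [X in _ <= X + _]big1//= prodr_const card_ord => hd.
(* The first bound yields [r + a <= (1 + h) * (r - b)]; the other two make [r - b] and [r + a]
   positive. *)
exists (Num.max (b + (a + b) / h) (Num.max b (- a))) => r.
rewrite !gt_max => /and3P[abr br ar].
split; first by rewrite subr_gt0.
apply: (@le_trans _ _ (((1 + h) * (r - b)) ^+ d)).
  apply: lerXn2r; rewrite ?nnegrE; [lra| |].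
    by rewrite mulr_ge0 ?subr_ge0 ?addr_ge0// ltW.
  have : (a + b) / h < r - b by lra.
  by rewrite ltr_pdivrMr//; nra.
by rewrite exprMn ler_wpM2r// exprn_ge0// subr_ge0 ltW.
Qed.

(** * Lattice points in dilates of a convex body *)

Lemma compact_coord_bounded (R : realType) (d : nat) (A : set 'rV[R]_d) :
  compact A -> exists2 M, 0 < M & forall x, A x -> forall i, `|x 0 i| <= M.
Proof.
move=> /compact_bounded[M [_ AM]]; exists (Num.max M 0 + 1).
  by rewrite ltr_wpDl// le_max lexx orbT.
move=> x Ax i; apply: le_trans (AM (Num.max M 0 + 1) _ x Ax).
  rewrite [leRHS]mx_normrE.
  by apply: (@le_bigmax _ _ _ 0 (fun ij => `|x ij.1 ij.2|) (0, i)).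
by rewrite ltr_pwDr// le_max lexx.
Qed.

Lemma interior_coord_ball (R : realType) (d : nat) (K : set 'rV[R]_d) :
  interior K !=set0 -> exists k0 : 'rV[R]_d, exists2 rho, 0 < rho &
    forall u : 'rV[R]_d, (forall i, `|u 0 i| <= rho) -> K (k0 + u).
Proof.
move=> [k0 /nbhs_ballP[e /= e0 eK]]; exists k0, (e / 2); first exact: divr_gt0.
move=> u ue; apply: eK; split=> // i j; rewrite !mxE.
rewrite /ball/= opprD addrA subrr sub0r normrN.
by rewrite (ord1 i) (le_lt_trans (ue j))// ltr_pdivrMr// ltr_pMr// ltr1n.
Qed.

Lemma convex_set_comb (R : realType) (d : nat) (K : set 'rV[R]_d)
    (x y : 'rV[R]_d) (t : R) :
  convex_set K -> K x -> K y -> 0 <= t -> t <= 1 ->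
  K (t *: x + (1 - t) *: y).
Proof.
move=> cK Kx Ky t0 t1.
have := cK x y (Itv01 t0 t1); rewrite !inE; exact.
Qed.

(** Convexity gives [r K + t K = (r + t) K], and [u + t *: k0] lies in [t K]; the translation by
    [- t *: k0] compensates for the centre of the ball. *)
Lemma dilate_fatten (R : realType) (d : nat) (K : set 'rV[R]_d)
    (k0 : 'rV[R]_d) (rho r t : R) (x u v : 'rV[R]_d) :
  convex_set K ->
  (forall u : 'rV[R]_d, (forall i, `|u 0 i| <= rho) -> K (k0 + u)) ->
  0 <= r -> 0 < t -> (forall i, `|u 0 i| <= t * rho) ->
  dilate K r x v -> dilate K (r + t) (x - t *: k0) (v + u).
Proof.
move=> cK Krho r0 t0 ut [k Kk <-]; have rt0 : 0 < r + t by rewrite ltr_wpDl.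
have Ku : K (k0 + t^-1 *: u).
  apply: Krho => i; rewrite mxE normrM gtr0_norm ?invr_gt0//.
  by rewrite ler_pdivrMl.
have := @convex_set_comb _ _ _ _ _ (r / (r + t)) cK Kk Ku.
rewrite divr_ge0 ?(ltW rt0)// ler_pdivrMr// mul1r lerDl (ltW t0).
move=> /(_ isT isT).
rewrite (_ : 1 - r / (r + t) = t / (r + t)); last by field; rewrite gt_eqF.
move=> Kc; exists (r / (r + t) *: k + t / (r + t) *: (k0 + t^-1 *: u)) => //.
apply/rowP => i; rewrite !mxE; field.
by rewrite !gt_eqF.
Qed.

Section lattice_point_count.
Variables (R : realType) (d : nat) (K : set 'rV[R]_d).
Variables (k0 : 'rV[R]_d) (rho : R).
Hypotheses (cK : convex_set K) (rho0 : 0 < rho).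
Hypothesis Krho :
  forall u : 'rV[R]_d, (forall i, `|u 0 i| <= rho) -> K (k0 + u).

(** Fattening by [t = rho^-1] absorbs offsets with coordinates at most 1, so the unit cubes at the
    lattice points of the dilate stay in the fattened one. *)
Lemma counting_dilate_le (r : R) (x : 'rV[R]_d) : 0 <= r ->
  (counting (lattice_trace (dilate K r x)) <=
   ((r + rho^-1) ^+ d)%:E * lebesgue_outer K)%E.
Proof.
move=> r0.
rewrite -(@lebesgue_outer_dilate _ _ _ _ (x - rho^-1 *: k0)); last first.
  by rewrite ltr_wpDl// invr_gt0.
apply: counting_le_lebesgue => z zK y /unit_cubeE zy.
rewrite -(subrK (lattice_embedding R z) y) [_ + lattice_embedding R z]addrC.
apply: (dilate_fatten cK Krho) => //; first by rewrite invr_gt0.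
move=> i; rewrite mulVf ?gt_eqF// !mxE.
have /andP[zy1 zy2] := zy i.
by rewrite ger0_norm ?subr_ge0// lerBlDl.
Qed.

(** Every point of the smaller dilate lies in the unit cube at its coordinatewise floor, and
    fattening by [rho^-1] shows that this floor belongs to the larger dilate. *)
Lemma counting_dilate_ge (r : R) (x : 'rV[R]_d) : 0 < r ->
  ((r ^+ d)%:E * lebesgue_outer K <=
   counting (lattice_trace (dilate K (r + rho^-1) x)))%E.
Proof.
move=> r0; rewrite -(@lebesgue_outer_dilate _ _ _ _ (x + rho^-1 *: k0))//.
apply: lebesgue_le_counting => y yK.
pose z : 'rV[int]_d := \row_i Num.floor (y 0 i).
have zy i : (z 0 i)%:~R <= y 0 i <= (z 0 i)%:~R + 1.
  by rewrite mxE floor_le/= -[1]/(1%:~R) -rmorphD/= ltW// floorD1_gt.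
exists z; last exact/unit_cubeE.
rewrite /lattice_trace/= -(addrK (rho^-1 *: k0) x).
rewrite -(subrK y (lattice_embedding R z)) [_ + y]addrC.
apply: (dilate_fatten cK Krho) => //; [exact: ltW|by rewrite invr_gt0|].
move=> i; rewrite mulVf ?gt_eqF//.
have /andP[zy1 zy2] := zy i; rewrite !mxE in zy1 zy2 *.
by rewrite distrC ger0_norm ?subr_ge0// lerBlDl.
Qed.

(** Dilated by [rho^-1] and recentred, [K] contains the unit cube at 0. *)
Lemma lebesgue_outer_gt0 : (0 < lebesgue_outer K)%E.
Proof.
have r0 : 0 < rho^-1 by rewrite invr_gt0.
have rd : 0 < (rho^-1) ^+ d by rewrite exprn_gt0.
suff : (1%:E <= (rho^-1 ^+ d)%:E * lebesgue_outer K)%E.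
  rewrite lt_def lebesgue_outer_ge0 andbT; apply: contraPneq => ->.
  by rewrite mule0 lee_fin ler10.
rewrite -(@lebesgue_outer_dilate _ _ _ _ (- (rho^-1 *: k0)))//.
apply: (@cubes_le_lebesgue _ _ 1 (fun=> 0)) => [i j _|_ y /unit_cubeE y01].
  by rewrite (ord1 i) (ord1 j).
exists (k0 + rho *: y); last first.
  by rewrite scalerDr scalerA mulVf ?gt_eqF// scale1r addrC addKr.
apply: Krho => i; have := y01 i; rewrite !mxE add0r => /andP[y0 y1].
by rewrite ger0_norm ?mulr_ge0 ?(ltW rho0)// ler_piMr// ltW.
Qed.

End lattice_point_count.

Lemma lebesgue_outer_lty (R : realType) (d : nat) (K : set 'rV[R]_d) :
  compact K -> (lebesgue_outer K < +oo)%E.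
Proof.
move=> /compact_coord_bounded[M M0 KM].
apply: le_lt_trans (@lebesgue_outer_box _ _ (const_mx (- M)) (const_mx M) _).
  by apply: le_lebesgue_outer => x Kx i; rewrite !mxE -ler_norml KM.
by move=> i; rewrite !mxE; lra.
Qed.

(** * Comparison of the two densities in a general group *)

Section density_comparison.
Context {R : realType}.
Local Open Scope ereal_scope.

(** Discharges the factor [1 + e] left by the asymptotic comparisons. *)
Lemma lee_mulD1Pr (x y : \bar R) : 0 <= y ->
  (forall e : R, (0 < e)%R -> x <= (1 + e)%:E * y) -> x <= y.
Proof.
case: y => [y| |]; [|by move=> _ _; rewrite leey|by []].
rewrite lee_fin => y0 xy; apply/lee_addgt0Pr => e e0.
have y1 : (0 < y + 1)%R by rewrite ltr_wpDl.
(* Dividing by [y + 1] rather than [y] covers [y = 0], and still [e * y / (y + 1) <= e]. *)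
apply: le_trans (xy (e / (y + 1))%R _) _; first by rewrite divr_gt0.
rewrite -EFinM -EFinD lee_fin mulrDl mul1r lerD2l mulrAC ler_pdivrMr//.
by rewrite ler_wpM2l ?(ltW e0)// lerDl.
Qed.

Variables (G : topologicalZmodType) (S : set (set G)) (nu mu : set G -> \bar R).
Hypotheses (nu0 : forall V, 0 <= nu V) (mu0 : forall V, 0 <= mu V).

(** For a fixed [C], the sets [W r x] are admissible as [V], and adding [C] to them enlarges the
    measure at most by the factor [1 + e] over the denominator [m r]. The point of [I] shows that
    the supremum runs over a nonempty family. *)
Lemma limf_esup_le_upper_density (I : pointedType) (W : R -> I -> set G)
    (m : R -> \bar R) :
  (forall C : set G, compact C -> C !=set0 -> forall e : R, (0 < e)%R ->
    exists r0 : R, forall r, (r0 < r)%R ->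
      [/\ m r \is a fin_num, 0 < m r,
          forall x, (S `&` @bounded_borel G) (W r x) &
          forall x, mu (minkowski_sum C (W r x)) <= (1 + e)%:E * m r]) ->
  limf_esup (fun r => ereal_sup [set nu (W r x) | x in setT] / m r) +oo_R
    <= upper_density S nu mu.
Proof.
move=> hW; apply: le_ereal_inf_tmp => _ [C [cC C0] <-].
set D := ereal_sup _.
have ratio0 C' V : 0 <= nu V / mu (minkowski_sum C' V).
  by rewrite mule_ge0// inve_ge0.
have D0 : 0 <= D.
  have [r0 /(_ (r0 + 1)%R)[|_ _ WS _]] := hW _ cC C0 _ (@ltr01 R).
    by rewrite ltrDl.
  apply: le_trans (ratio0 C (W (r0 + 1)%R point)) _.
  by apply: ereal_sup_ubound; exists (W (r0 + 1)%R point).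
apply: lee_mulD1Pr => // e e0; have e1 : (0 < 1 + e)%R by rewrite addr_gt0.
have [r0 hr] := hW _ cC C0 _ e0.
(* The limit superior is an infimum over neighbourhoods of [+oo]; the ray [r0 < r] is the one
   tested. *)
apply: ge_ereal_inf; eexists.
  by exists [set r | (r0 < r)%R] => //; exists r0; split => //; exact: num_real.
apply: ge_ereal_sup => _ [r /= r0r <-].
have [mfin m0 WS muW] := hr r r0r.
have mE : m r = (fine (m r))%:E by rewrite fineK.
have fm0 : (0 < fine (m r))%R by rewrite -lte_fin -mE.
rewrite mE inver gt_eqF// lee_pdivrMr//; apply: ge_ereal_sup => _ [x _ <-].
have muWx := muW x.
have nuD : nu (W r x) / mu (minkowski_sum C (W r x)) <= D.
  by apply: ereal_sup_ubound; exists (W r x).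
move: nuD muWx (mu0 (minkowski_sum C (W r x))).
rewrite mE; case: (mu _) => [q| |]; last 2 first.
- by move=> _; rewrite -EFinM leye_eq => /eqP.
- by [].
rewrite -EFinM !lee_fin => nuD qm q0.
(* If [C + W r x] is null, the quotient is [+oo] unless [nu (W r x) = 0]; so either [D = +oo] or the
   left side vanishes. *)
move: q0 nuD; rewrite [(0 <= q)%R]le_eqVlt => /predU1P[q0|q0].
  rewrite -q0 inve0; have := nu0 (W r x).
  rewrite [0 <= nu _]le_eqVlt => /predU1P[<- _|nuW].
    by rewrite !mule_ge0// lee_fin ltW.
  rewrite gt0_muley// leye_eq => /eqP->.
  by rewrite gt0_muley ?lte_fin// gt0_mulye ?leey.
rewrite inver gt_eqF// lee_pdivrMr// => /le_trans; apply.
by rewrite [_ * D]muleC -muleA lee_wpmul2l// -EFinM lee_fin.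
Qed.

(** In each neighbourhood of [+oo] one large [r] is enough: its set [C] tests the infimum that
    defines the upper density, and [f r / m r] is at most the supremum [s] over the
    neighbourhood. *)
Lemma upper_density_le_limf_esup (f m : R -> \bar R) :
  (forall r, 0 <= f r) ->
  (forall e : R, (0 < e)%R -> exists r0 : R, forall r, (r0 < r)%R ->
    [/\ m r \is a fin_num, 0 < m r &
        exists2 C : set G, compact C /\ C !=set0 &
        forall V, (S `&` @bounded_borel G) V ->
          nu V * m r <= (1 + e)%:E * f r * mu (minkowski_sum C V)]) ->
  upper_density S nu mu <= limf_esup (fun r => f r / m r) +oo_R.
Proof.
move=> f0 hC; apply: le_ereal_inf_tmp => _ [A [r1 [_ r1A]] <-].
set s := ereal_sup _.
have gs r : (r1 < r)%R -> f r / m r <= s.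
  by move=> r1r; apply: ereal_sup_ubound; exists r => //; exact: r1A.
have s0 : 0 <= s.
  have [r0 hr] := hC _ (@ltr01 R).
  have rr : (Num.max r0 r1 < Num.max r0 r1 + 1)%R by rewrite ltrDl.
  move: rr; rewrite {1}gt_max => /andP[/hr[_ m0 _] /gs]; apply: le_trans.
  by rewrite mule_ge0// inve_ge0 ltW.
apply: lee_mulD1Pr => // e e0; have e1 : (0 < 1 + e)%R by rewrite addr_gt0.
have [r0 hr] := hC _ e0.
have : (Num.max r0 r1 < Num.max r0 r1 + 1)%R by rewrite ltrDl.
rewrite {1}gt_max; set r := (_ + 1)%R => /andP[/hr[mfin m0 [C cC CV]] /gs].
have mE : m r = (fine (m r))%:E by rewrite fineK.
have fm0 : (0 < fine (m r))%R by rewrite -lte_fin -mE.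
rewrite {1}mE inver gt_eqF// lee_pdivrMr// -mE => fs.
apply: ge_ereal_inf; eexists; first by exists C.
apply: ge_ereal_sup => _ [V SV <-].
(* After multiplication by [m r], the bound [f r <= s * m r] replaces [f r] in the hypothesis on
   [C]. *)
have : nu V <= (1 + e)%:E * s * mu (minkowski_sum C V).
  rewrite -(@lee_pmul2r _ (m r))//; apply: le_trans (CV V SV) _.
  rewrite [leRHS]muleAC lee_wpmul2r// -muleA lee_wpmul2l// lee_fin.
  exact: ltW.
move: (mu0 (minkowski_sum C V)).
have es0 : 0 <= (1 + e)%:E * s by rewrite mule_ge0// lee_fin ltW.
(* For infinite measure the quotient is 0; for measure 0 the bound just proved forces [nu V = 0],
   and the quotient is [0 / 0 = 0]. *)
case: (mu _) => [q| |]; [|by move=> *; rewrite invey mule0|by []].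
rewrite lee_fin [(0 <= q)%R]le_eqVlt => /predU1P[<-|q0].
  rewrite mule0 => nuV; have -> : nu V = 0 by apply/le_anti; rewrite nuV nu0.
  by rewrite mul0e.
by rewrite inver gt_eqF// lee_pdivrMr.
Qed.

End density_comparison.

(** * Counting measure and double counting *)

Lemma counting_image (R : realType) (T U : choiceType) (f : T -> U)
    (A : set T) :
  injective f -> counting (f @` A) = counting A :> \bar R.
Proof.
move=> finj; rewrite /counting; case: asboolP => [finfA|inffA].
  have finA : finite_set A.
    by rewrite -(eq_finite_set (inj_card_eq (in2W finj))).
  by rewrite asboolT// fset_set_image// card_imfset.
by rewrite asboolF//; apply: contra_not inffA; exact: finite_image.
Qed.

Lemma le_counting (R : realType) (T : choiceType) (A B : set T) :
  A `<=` B -> (counting A <= counting B :> \bar R)%E.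
Proof.
move=> AB; rewrite /counting.
case: (asboolP (finite_set B)) => [finB|_]; last exact: leey.
have finA := sub_finite_set AB finB.
rewrite asboolT// lee_fin ler_nat fsubset_leq_card//.
by rewrite -(fset_set_sub finA finB).
Qed.

Lemma finite_set_counting_lty (R : realType) (T : choiceType) (A : set T) :
  (counting A < +oo :> \bar R)%E -> finite_set A.
Proof. by rewrite /counting; case: asboolP. Qed.

(** Double counting by integration: over [V], the sum of the indicators of the [A i] is at least
    [n], while its integral is the sum of the [mu (A i]&[V)], each at most [s]. *)
Lemma measure_multiplicity d (T : measurableType d) (R : realType)
    (mu : {measure set T -> \bar R}) (I : choiceType) (F : set I)
    (A : I -> set T) (V : set T) (n s : \bar R) :
  finite_set F -> measurable V -> (forall i, measurable (A i)) ->
  (forall y, V y -> n <= counting [set i | F i /\ A i y])%E ->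
  (forall i, mu (A i) <= s)%E -> (0 <= n)%E ->
  (n * mu V <= counting F * s)%E.
Proof.
move=> finF mV mA nA As n0.
have countE y : counting [set i | F i /\ A i y] =
    (\sum_(i <- fset_set F) (\1_(A i) y)%:E)%E :> \bar R.
  have finFA : finite_set [set i | F i /\ A i y].
    by apply: sub_finite_set finF => i [].
  rewrite /counting asboolT// sumEFin; congr EFin.
  under eq_bigr do rewrite indicE.
  rewrite -natr_sum card_fset_sum1 -big_mkcond/=; congr (_%:R).
  rewrite -[RHS]big_filter; apply: perm_big; apply: uniq_perm.
  - exact: fset_uniq.
  - by rewrite filter_uniq// fset_uniq.
  - move=> i; rewrite mem_filter !in_fset_set//=.
    by apply/idP/andP; rewrite !inE => -[].
rewrite -integral_cst//.
apply: (@le_trans _ _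
  (\int[mu]_(y in V) (\sum_(i <- fset_set F) (\1_(A i) y)%:E))%E).
  apply: ge0_le_integral => //.
  - apply: emeasurable_sum => i; exact/measurable_EFinP/measurable_indic.
  - by move=> y Vy; rewrite -countE nA.
rewrite ge0_integral_sum//; last first.
  by move=> i; exact/measurable_EFinP/measurable_indic.
rewrite /counting asboolT//.
(* As [s] may be infinite, the multiple is unrolled by induction in the extended reals. *)
have -> : ((#|` fset_set F|)%:R%:E * s = \sum_(i <- fset_set F) s)%E.
  rewrite big_const_seq count_predT.
  elim: (size _) => [|k IH]; first by rewrite mul0e.
  by rewrite iterS -IH -natr1 addrC EFinD ge0_muleDl ?lee_fin// mul1e.
apply: lee_sum => i _; rewrite integral_indic//.
apply: le_trans (As i); apply: le_measure; rewrite ?inE//.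
exact: measurableI.
Qed.

(** * The Euclidean space *)

Lemma dilate_compact (R : realType) (d : nat) (K : set 'rV[R]_d) r x :
  compact K -> compact (dilate K r x).
Proof.
move=> cK.
apply: (@continuous_compact _ _ (fun k : 'rV[R]_d => r *: k + x)) => //.
apply: continuous_subspaceT => y.
exact: (cvgD (@scaler_continuous R 'rV[R]_d r y) (cvg_cst x)).
Qed.

Lemma compact_bounded_borel (R : realType) (d : nat) (A : set 'rV[R]_d) :
  compact A -> bounded_borel A.
Proof.
move=> cA; have clA := compact_closed (@norm_hausdorff _ _) cA.
split; last by rewrite -(closure_id A).1.
rewrite -[A]setCK; apply: sigma_algebraC.
by apply: sub_sigma_algebra; exact: closed_openC.
Qed.

Section euclidean.
Variables (R : realType) (d : nat) (K : set 'rV[R]_d).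
Hypothesis hK : convex_body K.
Variable S : set (set 'rV[R]_d).
Hypotheses (sS : sigma_algebra [set: 'rV[R]_d] S)
  (borelS : <<s [set U : set 'rV[R]_d | open U] >> `<=` S).
Variable nu : {measure set (g_sigma_algebraType S) -> \bar R}.

Lemma dilate_bounded_borel r x : (S `&` @bounded_borel 'rV[R]_d) (dilate K r x).
Proof.
have [cK _ _] := hK.
have := compact_bounded_borel (@dilate_compact _ _ _ r x cK).
by move=> bK; split => //; apply: borelS; case: bK.
Qed.

Lemma lebesgue_dilate_pos r : 0 < r ->
  lebesgue_outer (dilate K r 0) \is a fin_num /\
  (0 < lebesgue_outer (dilate K r 0))%E.
Proof.
have [cK _ /interior_coord_ball[k0 [rho rho0 Krho]]] := hK.
have KL := lebesgue_outer_lty cK; have K0 := lebesgue_outer_gt0 rho0 Krho.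
move=> r0; rewrite lebesgue_outer_dilate//.
rewrite fin_numM// ?mule_gt0// ?lte_fin ?exprn_gt0//.
by rewrite ge0_fin_numE ?ltW.
Qed.

Lemma classical_density_le :
  (classical_density K nu <= upper_density S nu (@lebesgue_outer R d))%E.
Proof.
have [cK cvxK /interior_coord_ball[k0 [rho rho0 Krho]]] := hK.
apply: (@limf_esup_le_upper_density R 'rV[R]_d S nu _ _ _ _ (dilate K)).
- by move=> V; exact: measure_ge0.
- exact: lebesgue_outer_ge0.
move=> C /compact_coord_bounded[M M0 CM] _ e e0.
(* Chosen so that [t * rho = M] bounds the coordinates of [C], as [dilate_fatten] requires. *)
pose t := M / rho; have t0 : 0 < t by rewrite divr_gt0.
have [r0 hr] := exprD_asymp d t 0 e0; exists (Num.max r0 0) => r.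
rewrite gt_max => /andP[/hr[_ ler] rp].
have [mfin m0] := lebesgue_dilate_pos rp.
split=> // x; first exact: dilate_bounded_borel.
apply: (@le_trans _ _ (lebesgue_outer (dilate K (r + t) (x - t *: k0)))).
  apply: le_lebesgue_outer => _ [c Cc [v Kv <-]]; rewrite [c + v]addrC.
  apply: (dilate_fatten cvxK Krho) => //; first exact: ltW.
  by move=> i; rewrite mulfVK ?gt_eqF// CM.
rewrite !lebesgue_outer_dilate ?addr_gt0// muleA -EFinM.
by rewrite lee_wpmul2r ?lebesgue_outer_ge0// lee_fin -[r in leRHS]subr0.
Qed.

Lemma upper_density_le :
  (upper_density S nu (@lebesgue_outer R d) <= classical_density K nu)%E.
Proof.
have [cK cvxK /interior_coord_ball[k0 [rho rho0 Krho]]] := hK.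
have [B B0 KB] := compact_coord_bounded cK.
apply: upper_density_le_limf_esup.
- by move=> V; exact: measure_ge0.
- exact: lebesgue_outer_ge0.
- move=> r; apply: le_trans (measure_ge0 nu (dilate K r 0)) _.
  by apply: ereal_sup_ubound; exists 0.
move=> e e0; have rV0 : 0 < rho^-1 by rewrite invr_gt0.
have [r0 hr] := exprD_asymp d 0 rho^-1 e0; exists (Num.max r0 0) => r.
rewrite gt_max => /andP[/hr[rt0 ler] rp]; rewrite addr0 in ler.
have [mfin m0] := lebesgue_dilate_pos rp; split=> //.
set f := ereal_sup _.
(* If [y = r *: k + z] lies in [V] and [w] in the unit cube at [z], then [w - y] has coordinates at
   most [1] from the cube plus [r * B] from [r *: k], so [w] lies in [C + V]. *)
pose C : set 'rV[R]_d := box (const_mx (- (r * B + 1))) (const_mx (r * B + 1)).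
exists C.
  split; first exact: box_compact.
  exists 0 => i; rewrite !mxE oppr_le0 andbb.
  by rewrite addr_ge0// mulr_ge0// ltW.
move=> V [SV [_ cV]].
have [Q Q0 VQ] := compact_coord_bounded cV.
pose A (z : lattice d) := dilate K r (lattice_embedding R z).
pose F := [set z | exists2 y, V y & A z y].
have FC : (counting F <= lebesgue_outer (minkowski_sum C V))%E.
  apply: counting_le_lebesgue => z [y Vy [k Kk kzy]] w /unit_cubeE zw.
  exists (w - y); last by exists y => //; rewrite subrK.
  move=> i; have := zw i; have := KB _ Kk i; rewrite -kzy !mxE.
  rewrite ler_norml => /andP[kB1 kB2] /andP[zw1 zw2].
  by apply/andP; split; nra.
(* The closure of [V] is compact, so [C + V] lies in a box; finite volume makes [F] finite, as the
   double count requires. *)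
have CVfin : (lebesgue_outer (minkowski_sum C V) < +oo)%E.
  pose P := r * B + 1 + Q.
  apply: le_lt_trans (@lebesgue_outer_box _ _ (const_mx (- P)) (const_mx P) _).
    apply: le_lebesgue_outer => _ [c Cc [v Vv <-]] i.
    have := Cc i; have := VQ v (subset_closure Vv) i.
    rewrite ler_norml !mxE /P => /andP[vQ1 vQ2] /andP[cr1 cr2].
    by apply/andP; split; lra.
  move=> i; rewrite !mxE /P; have := mulr_gt0 rp B0; lra.
have finF : finite_set F by apply/finite_set_counting_lty/(le_lt_trans FC).
pose n := (((r - rho^-1) ^+ d)%:E * lebesgue_outer K)%E.
have n0 : (0 <= n)%E.
  by rewrite mule_ge0 ?lebesgue_outer_ge0// lee_fin exprn_ge0// ltW.
have nuV : (n * nu V <= counting F * f)%E.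
  apply: (@measure_multiplicity _ (g_sigma_algebraType S) _ nu _ _ A) => //.
  - exact: sub_sigma_algebra.
  - move=> z; apply: sub_sigma_algebra.
    by have [] := dilate_bounded_borel r (lattice_embedding R z).
  - move=> y Vy.
    (* A point [y] lies in [r K + z] exactly when [- z] lies in [r K - y]; negation thus turns the
       multiplicity at [y] into the number of lattice points of a dilate, bounded below by [n]. *)
    rewrite -(@counting_image _ _ _ (-%R : lattice d -> lattice d)); last first.
      exact: oppr_inj.
    apply: le_trans (counting_dilate_ge (k0 := k0) cvxK rho0 Krho (- y) rt0) _.
    rewrite subrK; apply: le_counting => z [k Kk kz].
    have Ay : A (- z) y.
      exists k => //; apply/rowP => i; have /rowP/(_ i) := kz.
      by rewrite !mxE rmorphN/=; lra.
    by exists (- z); rewrite ?opprK//; split=> //; exists y.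
  - by move=> z; apply: ereal_sup_ubound; exists (lattice_embedding R z).
have mE : (lebesgue_outer (dilate K r 0) <= (1 + e)%:E * n)%E.
  rewrite lebesgue_outer_dilate// /n muleA -EFinM.
  by rewrite lee_wpmul2r ?lebesgue_outer_ge0// lee_fin.
apply: le_trans (lee_wpmul2l (measure_ge0 nu V) mE) _.
rewrite muleCA -muleA lee_wpmul2l ?lee_fin ?addr_ge0 ?(ltW e0)//.
rewrite muleC (le_trans nuV)// muleC lee_wpmul2l//.
apply: le_trans (measure_ge0 nu (dilate K r 0)) _.
by apply: ereal_sup_ubound; exists 0.
Qed.
End euclidean.

(** * The integer lattice *)

Lemma lattice_compact_coord_bounded (R : realType) (d : nat)
    (C : set (lattice d)) :
  compact C -> exists2 M, 0 < M &
    forall z, C z -> forall i, `|lattice_embedding R z 0 i| <= M.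
Proof.
move=> cC; have : compact (@lattice_embedding R d @` C).
  apply: continuous_compact => //; apply: continuous_subspaceT => z A.
  move=> /nbhs_singleton Az.
  by apply: (@filterS _ (nbhs z) _ _ _ _ (discrete_set1 z)) => _ ->.
move=> /compact_coord_bounded[M M0 CM]; exists M => // z Cz i.
by apply: CM; exists z.
Qed.

(** The unit cubes at the points of [C] all lie in one box of finite volume. *)
Lemma lattice_compact_finite (R : realType) (d : nat) (C : set (lattice d)) :
  compact C -> finite_set C.
Proof.
move=> /(@lattice_compact_coord_bounded R)[M M0 CM].
apply/(@finite_set_counting_lty R)/(@le_lt_trans _ _ (lebesgue_outer
  (box (const_mx (- M) : 'rV[R]_d) (const_mx (M + 1))))).
  apply: counting_le_lebesgue => z Cz y /unit_cubeE zy i.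
  have := zy i; have := CM z Cz i; rewrite ler_norml !mxE.
  by move=> /andP[? ?] /andP[? ?]; apply/andP; split; lra.
by apply: lebesgue_outer_box => i; rewrite !mxE; lra.
Qed.

Lemma lattice_bounded_borel (d : nat) (A : set (lattice d)) :
  finite_set A -> bounded_borel A.
Proof.
move=> finA; split.
  by apply: sub_sigma_algebra; exact: discrete_open.
rewrite -(closure_id A).1; last exact: discrete_closed.
exact: finite_compact.
Qed.

Section lattice_density.
Variables (R : realType) (d : nat) (K : set 'rV[R]_d).
Hypothesis hK : convex_body K.
Variable nu : {measure set (g_sigma_algebraType [set: set (lattice d)])
                 -> \bar R}.

Local Notation W r x := (lattice_trace (dilate K r (lattice_embedding R x))).

Lemma lattice_dilate_finite r x : 0 <= r ->
  (counting (lattice_trace (dilate K r x)) < +oo :> \bar R)%E.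
Proof.
have [cK cvxK /interior_coord_ball[k0 [rho rho0 Krho]]] := hK => r0.
apply: le_lt_trans (counting_dilate_le cvxK rho0 Krho _ r0) _.
have := lebesgue_outer_lty cK; have := lebesgue_outer_ge0 K.
by case: (lebesgue_outer K) => // l _ _; rewrite -EFinM ltry.
Qed.

Lemma lattice_classical_density_le :
  (lattice_classical_density K nu
   <= upper_density [set: set (lattice d)] nu counting)%E.
Proof.
have [cK cvxK /interior_coord_ball[k0 [rho rho0 Krho]]] := hK.
have K0 := lebesgue_outer_gt0 rho0 Krho.
have rV0 : 0 < rho^-1 by rewrite invr_gt0.
apply: (@limf_esup_le_upper_density R (lattice d) _ nu _ _ _ (lattice d)
  (fun r x => W r x)).
- by move=> V; exact: measure_ge0.
- by move=> V; rewrite /counting; case: asboolP.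
move=> C /(@lattice_compact_coord_bounded R)[M M0 CM] _ e e0.
pose t := M / rho; have t0 : 0 < t by rewrite divr_gt0.
(* In the numerator [t] absorbs [C] and [rho^-1] comes from the upper lattice count; the [rho^-1] of
   the denominator comes from the lower count for [m r]. *)
have [r0 hr] := exprD_asymp d (t + rho^-1) rho^-1 e0.
exists (Num.max r0 0) => r; rewrite gt_max => /andP[/hr[rt0 ler] rp].
have mge : (((r - rho^-1) ^+ d)%:E * lebesgue_outer K <=
    counting (lattice_trace (dilate K r 0)))%E.
  by rewrite -[r in leRHS](subrK rho^-1) (counting_dilate_ge cvxK rho0 Krho).
have m0 : (0 < counting (lattice_trace (dilate K r 0)) :> \bar R)%E.
  by apply: lt_le_trans mge; rewrite mule_gt0// lte_fin exprn_gt0.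
split=> //.
- by rewrite ge0_fin_numE ?ltW// lattice_dilate_finite// ltW.
- move=> x; split=> //; apply: lattice_bounded_borel.
  by apply: (@finite_set_counting_lty R); rewrite lattice_dilate_finite// ltW.
move=> x; apply: (@le_trans _ _ (counting (lattice_trace
    (dilate K (r + t) (lattice_embedding R x - t *: k0))))).
  apply: le_counting => _ [c Cc [v Kv <-]]; rewrite /lattice_trace/=.
  have -> : lattice_embedding R (c + v) =
      lattice_embedding R v + lattice_embedding R c.
    by apply/rowP => i; rewrite !mxE rmorphD addrC.
  apply: (dilate_fatten cvxK Krho) => //; first exact: ltW.
  by move=> i; rewrite mulfVK ?gt_eqF// CM.
apply: le_trans (counting_dilate_le cvxK rho0 Krho _ _) _.
  by rewrite addr_ge0// ltW.
have e1 : (0 <= (1 + e)%:E)%E by rewrite lee_fin addr_ge0// ltW.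
apply: le_trans (lee_wpmul2l e1 mge).
by rewrite muleA -EFinM lee_wpmul2r ?(ltW K0)// lee_fin -addrA.
Qed.

Lemma lattice_upper_density_le :
  (upper_density [set: set (lattice d)] nu counting
   <= lattice_classical_density K nu)%E.
Proof.
have [cK cvxK /interior_coord_ball[k0 [rho rho0 Krho]]] := hK.
have K0 := lebesgue_outer_gt0 rho0 Krho.
have rV0 : 0 < rho^-1 by rewrite invr_gt0.
apply: upper_density_le_limf_esup.
- by move=> V; exact: measure_ge0.
- by move=> V; rewrite /counting; case: asboolP.
- move=> r; apply: le_trans (measure_ge0 nu (W r 0)) _.
  by apply: ereal_sup_ubound; exists 0.
(* Radii beyond [rho^-1] are those for which [counting_dilate_ge] provides a lattice point of
   [r K]. *)
move=> e e0; exists rho^-1 => r rr.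
have rp : 0 < r by exact: lt_trans rr.
set f := ereal_sup _.
pose W0 := lattice_trace (dilate K r 0).
have f0 : (0 <= f)%E.
  apply: le_trans (measure_ge0 nu (W r 0)) _.
  by apply: ereal_sup_ubound; exists 0.
have m0 : (0 < counting W0 :> \bar R)%E.
  rewrite /W0 -(subrK rho^-1 r).
  apply: lt_le_trans (counting_dilate_ge cvxK rho0 Krho _ _); last first.
    by rewrite subr_gt0.
  by rewrite mule_gt0// lte_fin exprn_gt0// subr_gt0.
have finW : (counting W0 < +oo :> \bar R)%E.
  by apply: lattice_dilate_finite; exact: ltW.
have finW0 : finite_set W0 by exact: (@finite_set_counting_lty R).
split=> //; first by rewrite ge0_fin_numE ?(ltW m0).
(* A lattice point [y] lies in [W r z] exactly when [z = y - w] with [w] in [W0]; hence every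
   translate that meets [V] has its [z] in [C + V]. *)
exists (-%R @` W0); first split.
- by apply: finite_compact; exact: finite_image.
- have [W00|/set0P[w Ww]] := eqVneq W0 set0; last by exists (- w), w.
  by move: m0; rewrite W00 /counting asboolT// fset_set0 ltxx.
move=> V [_ [_ cV]].
have finV : finite_set V.
  apply: (@lattice_compact_finite R); rewrite (closure_id V).1//.
  exact: discrete_closed.
(* The index set of the double count is [C + V] itself; the translates containing [y] include those
   indexed by [y - w] for [w] in [W0], one for each [w]. *)
have : (counting W0 * nu V <= counting (minkowski_sum (-%R @` W0) V) * f)%E.
  apply: (@measure_multiplicity _ (g_sigma_algebraType [set: set (lattice d)])
    _ nu _ _ (fun z => W r z)) => //.
  - by apply: finite_image2 => //; exact: finite_image.
  - by apply: sub_sigma_algebra.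
  - by move=> z; apply: sub_sigma_algebra.
  - move=> y Vy.
    rewrite -(@counting_image _ _ _ (fun w : lattice d => y - w) W0); last first.
      by move=> w w' /addrI/oppr_inj.
    apply: le_counting => _ [w Ww <-]; split.
      by exists (- w); [exists w|exists y => //; rewrite addrC].
    have [k Kk kw] := Ww; exists k => //.
    apply/rowP => i; have /rowP/(_ i) := kw.
    by rewrite !mxE rmorphB/=; lra.
  - by move=> z; apply: ereal_sup_ubound; exists z.
  - exact: ltW.
rewrite muleC => /le_trans; apply; rewrite -muleA [leLHS]muleC.
rewrite -[leLHS]mul1e lee_wpmul2r//.
  by rewrite mule_ge0// /counting; case: asboolP.
by rewrite lee_fin lerDl ltW.
Qed.

End lattice_density.

Theorem theorem1 (R : realType) (d : nat) (K : set 'rV[R]_d)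
    (hK : convex_body K) :
  (forall (S : set (set 'rV[R]_d)),
     sigma_algebra [set: 'rV[R]_d] S ->
     <<s [set U : set 'rV[R]_d | open U] >> `<=` S ->
     forall nu : {measure set (g_sigma_algebraType S) -> \bar R},
       upper_density S nu (@lebesgue_outer R d) = classical_density K nu)
  /\
  (forall nu : {measure set (g_sigma_algebraType [set: set (lattice d)])
                 -> \bar R},
     upper_density [set: set (lattice d)] nu counting
     = lattice_classical_density K nu).
Proof.
split=> [S sS borelS nu|nu]; apply/le_anti/andP; split.
- exact: upper_density_le.
- exact: classical_density_le.
- exact: lattice_upper_density_le.
- exact: lattice_classical_density_le.
Qed.
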